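(* Let $\mathcal C$ be an $\infty$-category with pullbacks equipped with a connectivity structure, let $k$ be an integer, and let $X$ be an object of $\mathcal C$. Suppose that $A_1\to X$ and $A_2\to X$ are minimal $k$-skeleta of $X$. Then in the homotopy category $h\mathcal C$ there exists a unique isomorphism $A_1\simeq A_2$ over $X$.
   Context: A connectivity structure on $\mathcal C$ consists of, for each $k\in\mathbb Z$, a collection of $k$-connected maps in $h\mathcal C$ such that: (1) $k$-connected maps are $(k-1)$-connected; (2) equivalences are $k$-connected for all $k$; (3) the homotopy pullback of a $k$-connected map is $k$-connected; (4) for composable $f: X\to Y$, $g: Y\to Z$: (a) if $f$ and $g$ are $k$-connected, so is $gf$; (b) if $f$ is $(k-1)$-connected and $gf$ is $k$-connected, then $g$ is $k$-connected; (c) if $gf$ is $k$-connected and $g$ is $(k+1)$-connected, then $f$ is $k$-connected. An object $B$ is $k$-skeletal if, for any $k$-connected map $U\to V$, every map $B\to V$ in $h\mathcal C$ lifts to a map $B\to U$ in $h\mathcal C$. A map $f: A\to X$ is a minimal $k$-skeleton of $X$ if $A$ is $k$-skeletal and $f$ is $(k+1)$-connected. *)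

(* Defs.v *)
From HB Require Import structures.
From mathcomp Require Import all_boot all_order all_algebra.
From mathcomp Require Import boolp.
From mathcomp Require Import zify.

Set Implicit Arguments.
Unset Strict Implicit.
Unset Printing Implicit Defensive.

Record category := Category {
  obj :> Type;
  mor : obj -> obj -> Type;
  idm : forall x, mor x x;
  mcomp : forall x y z, mor y z -> mor x y -> mor x z;
  mcomp_idl : forall x y (f : mor x y), mcomp (idm y) f = f;
  mcomp_idr : forall x y (f : mor x y), mcomp f (idm x) = f;
  mcompA : forall w x y z (h : mor y z) (g : mor x y) (f : mor w x),
    mcomp h (mcomp g f) = mcomp (mcomp h g) f }.

Arguments idm {c} x.
Arguments mcomp {c x y z} g f.

Definition is_iso (C : category) (x y : C) (f : mor x y) : Prop :=
  exists g : mor y x, mcomp g f = idm x /\ mcomp f g = idm y.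

(* Face and degeneracy indices are given as natural numbers and read in the
   appropriate ordinal by [inord]; the simplicial identities are only required
   for indices in range. *)
Record sset := SSet {
  simplices :> nat -> Type;
  face : forall n, 'I_n.+2 -> simplices n.+1 -> simplices n;
  degen : forall n, 'I_n.+1 -> simplices n -> simplices n.+1;
  faceK : forall n i j (x : simplices n.+2), i < j <= n.+2 ->
    face (inord i) (face (inord j) x) = face (inord j.-1) (face (inord i) x);
  face_degen_lt : forall n i j (x : simplices n.+1), i < j <= n.+1 ->
    face (inord i) (degen (inord j) x) = degen (inord j.-1) (face (inord i) x);
  face_degen_eq : forall n j (x : simplices n), j <= n ->
    face (inord j) (degen (inord j) x) = x;
  face_degen_succ : forall n j (x : simplices n), j <= n ->
    face (inord j.+1) (degen (inord j) x) = x;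
  face_degen_gt : forall n i j (x : simplices n.+1), j.+1 < i <= n.+2 ->
    face (inord i) (degen (inord j) x) = degen (inord j) (face (inord i.-1) x);
  degenK : forall n i j (x : simplices n), i <= j <= n ->
    degen (inord i) (degen (inord j) x) = degen (inord j.+1) (degen (inord i) x)
}.

Definition d_ (X : sset) n (i : nat) (x : X n.+1) : X n := face (inord i) x.
Definition s_ (X : sset) n (i : nat) (x : X n) : X n.+1 := degen (inord i) x.
Arguments d_ {X n} i x.
Arguments s_ {X n} i x.

(* A map to X from the union of the faces of Delta^(n+1) indexed by D is a
   family of n-simplices agreeing on the intersections of these faces; for
   n = 0 the faces of Delta^1 are disjoint. *)
Definition matching (X : sset) n : pred 'I_n.+2 -> ('I_n.+2 -> X n) -> Prop :=
  match n with
  | 0 => fun D x => True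
  | m.+1 => fun D x => forall i j : 'I_m.+3,
      D i -> D j -> i < j -> d_ i (x j) = d_ j.-1 (x i)
  end.

(* Quasi-categories: every inner horn Lambda^(n+1)_k -> X extends to
   Delta^(n+1). *)
Record infcat := InfCat {
  infcat_sset :> sset;
  inner_horn : forall n (k : 'I_n.+2) (x : 'I_n.+2 -> infcat_sset n),
    0 < k < n.+1 -> matching [pred i | i != k] x ->
    exists y : infcat_sset n.+1, forall i, i != k -> face i y = x i }.

Section HomotopyCategory.
Variable C : infcat.

(* The face d_1 of an edge is its source and d_0 its target. *)
Record edge (x y : C 0) := Edge {
  earr : C 1;
  esrc : d_ 1 earr = x;
  etgt : d_ 0 earr = y }.

HB.instance Definition _ x y := gen_eqMixin (edge x y).
HB.instance Definition _ x y := gen_choiceMixin (edge x y).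

Lemma edge_inj x y (f g : edge x y) : earr f = earr g -> f = g.
Proof.
case: f g => f fs ft [g gs gt] /= efg; case: _ / efg gs gt => gs gt.
by congr Edge; apply: Prop_irrelevance.
Qed.

Lemma id_edge_src (x : C 0) : d_ 1 (s_ 0 x) = x.
Proof. exact: face_degen_succ. Qed.

Lemma id_edge_tgt (x : C 0) : d_ 0 (s_ 0 x) = x.
Proof. exact: face_degen_eq. Qed.

Definition id_edge (x : C 0) : edge x x := Edge (id_edge_src x) (id_edge_tgt x).

(* A 2-simplex with edges 01 = f, 12 = g, 02 = h. *)
Definition triangle x y z (f : edge x y) (g : edge y z) (h : edge x z) : Prop :=
  exists t : C 2, [/\ d_ 2 t = earr f, d_ 0 t = earr g & d_ 1 t = earr h].

Definition homotopic x y (f g : edge x y) : Prop := triangle f (id_edge y) g.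

Lemma horn3 k (x : nat -> C 2) : 0 < k < 3 ->
  (forall i j, i < j < 4 -> i != k -> j != k -> d_ i (x j) = d_ j.-1 (x i)) ->
  exists y : C 3, forall i, i < 4 -> i != k -> d_ i y = x i.
Proof.
move=> hk hx.
have [||y hy] := @inner_horn C 2 (inord k) (fun i => x i).
- by rewrite inordK //; lia.
- move=> i j; rewrite !inE -!val_eqE /= inordK; last by lia.
  by move=> ik jk ij; apply: hx => //; rewrite ij /= ltn_ord.
exists y => i hi ik; rewrite /d_ hy ?inordK //.
by apply: contraNneq ik => /(congr1 val) /=; rewrite !inordK //; lia.
Qed.

Lemma horn3_1 (t0 t2 t3 : C 2) :
  d_ 0 t2 = d_ 1 t0 -> d_ 0 t3 = d_ 2 t0 -> d_ 2 t3 = d_ 2 t2 ->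
  exists t1 : C 2,
    [/\ d_ 0 t1 = d_ 0 t0, d_ 1 t1 = d_ 1 t2 & d_ 2 t1 = d_ 1 t3].
Proof.
move=> e02 e03 e23.
have [//||y hy] := @horn3 1 (nth t0 [:: t0; t0; t2; t3]).
  by move=> [|[|[|[|i]]]] [|[|[|[|j]]]] //= /andP[_].
have := (hy 0 isT isT, hy 2 isT isT, hy 3 isT isT) => /= -[[y0 y2] y3].
by exists (d_ 1 y); split; rewrite -?y0 -?y2 -?y3;
  [ exact: (@faceK C 1 0 1) | symmetry; exact: (@faceK C 1 1 2)
  | symmetry; exact: (@faceK C 1 1 3)].
Qed.

Lemma horn3_2 (t0 t1 t3 : C 2) :
  d_ 0 t1 = d_ 0 t0 -> d_ 0 t3 = d_ 2 t0 -> d_ 1 t3 = d_ 2 t1 ->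
  exists t2 : C 2,
    [/\ d_ 0 t2 = d_ 1 t0, d_ 1 t2 = d_ 1 t1 & d_ 2 t2 = d_ 2 t3].
Proof.
move=> e01 e03 e13.
have [//||y hy] := @horn3 2 (nth t0 [:: t0; t1; t0; t3]).
  by move=> [|[|[|[|i]]]] [|[|[|[|j]]]] //= /andP[_].
have := (hy 0 isT isT, hy 1 isT isT, hy 3 isT isT) => /= -[[y0 y1] y3].
by exists (d_ 2 y); split; rewrite -?y0 -?y1 -?y3;
  [ exact: (@faceK C 1 0 2) | exact: (@faceK C 1 1 2)
  | symmetry; exact: (@faceK C 1 2 3)].
Qed.

Lemma triangle_idr x y (f : edge x y) : triangle f (id_edge y) f.
Proof.
exists (s_ 1 (earr f)); split.
- exact: face_degen_succ.
- by rewrite /= -[in RHS](etgt f); exact: (@face_degen_lt C 0 0 1).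
- exact: face_degen_eq.
Qed.

Lemma triangle_idl x y (f : edge x y) : triangle (id_edge x) f f.
Proof.
exists (s_ 0 (earr f)); split.
- by rewrite /= -[in RHS](esrc f); exact: (@face_degen_gt C 0 2 0).
- exact: face_degen_eq.
- exact: face_degen_succ.
Qed.

Lemma homotopic_triangle x y z (f : edge x y) (g g' : edge y z)
    (h h' : edge x z) :
  homotopic g g' -> triangle f g h -> triangle f g' h' -> homotopic h h'.
Proof.
move=> [t0 [a2 a0 a1]] [t3 [b2 b0 b1]] [t2 [c2 c0 c1]].
have [|||t1 [e0 e1 e2]] := @horn3_1 t0 t2 t3; rewrite ?a0 ?a1 ?a2 //.
  by rewrite b2.
by exists t1; rewrite e0 e1 e2.
Qed.

Lemma homotopic_refl x y (f : edge x y) : homotopic f f.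
Proof. exact: triangle_idr. Qed.

Lemma homotopic_euclid x y (f g h : edge x y) :
  homotopic f g -> homotopic f h -> homotopic g h.
Proof. exact: (homotopic_triangle (homotopic_refl _)). Qed.

Lemma homotopic_sym x y (f g : edge x y) : homotopic f g -> homotopic g f.
Proof. by move=> /homotopic_euclid; apply; exact: homotopic_refl. Qed.

Lemma homotopic_trans x y (f g h : edge x y) :
  homotopic f g -> homotopic g h -> homotopic f h.
Proof. by move=> /homotopic_sym /homotopic_euclid; apply. Qed.

Lemma triangle_homotopic_l x y z (f f' : edge x y) (g : edge y z)
    (h : edge x z) :
  homotopic f f' -> triangle f g h -> triangle f' g h.
Proof.
move=> [t3 [a2 a0 a1]] [t2 [b2 b0 b1]].
have [t0 [c2 c0 c1]] := triangle_idl g.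
have [|||t1 [e0 e1 e2]] := @horn3_1 t0 t2 t3.
- by rewrite b0 c1.
- by rewrite a0 c2.
- by rewrite a2 b2.
by exists t1; rewrite e0 e1 e2.
Qed.

Lemma triangle_homotopic x y z (f f' : edge x y) (g g' : edge y z)
    (h h' : edge x z) :
  homotopic f f' -> homotopic g g' -> triangle f g h -> triangle f' g' h' ->
  homotopic h h'.
Proof.
by move=> ff' gg' /(triangle_homotopic_l ff'); exact: homotopic_triangle.
Qed.

Lemma triangleA w x y z (f : edge w x) (g : edge x y) (h : edge y z)
    (gf : edge w y) (hg : edge x z) (k : edge w z) :
  triangle f g gf -> triangle g h hg -> triangle gf h k -> triangle f hg k.
Proof.
move=> [t3 [a2 a0 a1]] [t0 [b2 b0 b1]] [t1 [c2 c0 c1]].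
have [|||t2 [e0 e1 e2]] := @horn3_2 t0 t1 t3.
- by rewrite c0 b0.
- by rewrite a0 b2.
- by rewrite a1 c2.
by exists t2; rewrite e0 e1 e2.
Qed.

Lemma triangle_ex x y z (f : edge x y) (g : edge y z) :
  exists h : edge x z, triangle f g h.
Proof.
have [//||t ht] := @inner_horn C 1 (inord 1)
  (fun i => nth (earr f) [:: earr g; earr f; earr f] i).
- by rewrite inordK.
- move=> [[|[|[|i]]] hi] [[|[|[|j]]] hj] //=;
    rewrite -!val_eqE /= ?inordK //.
  by move=> _ _ _; rewrite etgt esrc.
have t0 : d_ 0 t = earr g.
  by rewrite /d_ ht ?inordK // -val_eqE /= !inordK.
have t2 : d_ 2 t = earr f.
  by rewrite /d_ ht ?inordK // -val_eqE /= !inordK.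
have hs : d_ 1 (d_ 1 t) = x.
  by rewrite -[in RHS](esrc f) -t2; symmetry; exact: (@faceK C 0 1 2).
have ht' : d_ 0 (d_ 1 t) = z.
  by rewrite -[in RHS](etgt g) -t0; exact: (@faceK C 0 0 1).
by exists (Edge hs ht'), t.
Qed.

Definition homotopic_rel x y : rel (edge x y) :=
  fun f g => `[< homotopic f g >].

Lemma homotopic_rel_refl x y : reflexive (@homotopic_rel x y).
Proof. by move=> f; apply/asboolP; exact: homotopic_refl. Qed.

Lemma homotopic_rel_sym x y : symmetric (@homotopic_rel x y).
Proof.
by move=> f g; apply/idP/idP => /asboolP H; apply/asboolP/homotopic_sym.
Qed.

Lemma homotopic_rel_trans x y : transitive (@homotopic_rel x y).
Proof.
move=> g f h /asboolP fg /asboolP gh; apply/asboolP.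
exact: homotopic_trans gh.
Qed.

Canonical homotopic_equiv x y := EquivRel (@homotopic_rel x y)
  (@homotopic_rel_refl x y) (@homotopic_rel_sym x y) (@homotopic_rel_trans x y).

Local Open Scope quotient_scope.

Definition hhom (x y : C 0) : Type := {eq_quot (homotopic_equiv x y)}.

Definition hclass x y (f : edge x y) : hhom x y :=
  \pi_({eq_quot (homotopic_equiv x y)}) f.

Definition hrepr x y (f : hhom x y) : edge x y :=
  repr (f : {eq_quot (homotopic_equiv x y)}).

Lemma hclassP x y (f g : edge x y) : hclass f = hclass g <-> homotopic f g.
Proof.
split; first by move=> /eqquotP /asboolP.
by move=> fg; apply/eqquotP/asboolP.
Qed.

Lemma hreprK x y (f : hhom x y) : hclass (hrepr f) = f.
Proof. exact: reprK. Qed.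

Definition hcomp x y z (g : hhom y z) (f : hhom x y) : hhom x z :=
  hclass (sval (cid (triangle_ex (hrepr f) (hrepr g)))).

Lemma hcompP x y z (f : edge x y) (g : edge y z) (h : edge x z) :
  triangle f g h -> hcomp (hclass g) (hclass f) = hclass h.
Proof.
move=> fgh; rewrite /hcomp; case: cid => k /= hk; apply/hclassP.
apply: triangle_homotopic hk fgh; apply/hclassP; exact: hreprK.
Qed.

Lemma hcomp_idl x y (f : hhom x y) : hcomp (hclass (id_edge y)) f = f.
Proof. by rewrite -[f]hreprK; apply/hcompP/triangle_idr. Qed.

Lemma hcomp_idr x y (f : hhom x y) : hcomp f (hclass (id_edge x)) = f.
Proof. by rewrite -[f]hreprK; apply/hcompP/triangle_idl. Qed.

Lemma hcompA w x y z (h : hhom y z) (g : hhom x y) (f : hhom w x) :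
  hcomp h (hcomp g f) = hcomp (hcomp h g) f.
Proof.
rewrite -[f]hreprK -[g]hreprK -[h]hreprK.
have [gf tgf] := triangle_ex (hrepr f) (hrepr g).
have [hg thg] := triangle_ex (hrepr g) (hrepr h).
have [k tk] := triangle_ex gf (hrepr h).
rewrite (hcompP tgf) (hcompP thg) (hcompP tk).
by rewrite (hcompP (triangleA tgf thg tk)).
Qed.

Definition hcat : category :=
  @Category (C 0) hhom (fun x => hclass (id_edge x)) hcomp
    hcomp_idl hcomp_idr hcompA.

End HomotopyCategory.

Fixpoint last_vertex (X : sset) n : X n -> X 0 :=
  match n with
  | 0 => fun x => x
  | m.+1 => fun x => last_vertex (d_ 0 x)
  end.

Fixpoint last_edge (X : sset) n : X n.+1 -> X 1 :=
  match n with
  | 0 => fun x => x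
  | m.+1 => fun x => last_edge (d_ 0 x)
  end.

(* Every map from the boundary of Delta^m (m >= 1) with last vertex a
   extends to Delta^m. *)
Definition final (X : sset) (a : X 0) : Prop :=
  forall n (x : 'I_n.+2 -> X n), matching predT x ->
    last_vertex (x ord0) = a ->
    exists y : X n.+1, forall i, face i y = x i.

(* The slice of X over the diagram p : Lambda^2_2 -> X given by two edges
   f and g with a common target.  Since Delta^n * Lambda^2_2 is the union of
   two copies of Delta^n * Delta^1 = Delta^(n+2) glued along the face
   Delta^n * {1} opposite to the vertex n+1, an n-simplex of X_{/p} is a pair
   of (n+2)-simplices with last edges f and g and with this face in common. *)
Section Slice.
Variables (X : sset) (f g : X 1).

Definition slice_cond n (st : X n.+2 * X n.+2) : Prop :=
  [/\ last_edge st.1 = f, last_edge st.2 = g & d_ n.+1 st.1 = d_ n.+1 st.2].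

Definition slice_simplices n : Type := {st : X n.+2 * X n.+2 | slice_cond st}.

Lemma last_edgeS n (x : X n.+2) : last_edge x = last_edge (d_ 0 x).
Proof. by []. Qed.

Lemma last_edge_face n i (x : X n.+2) : i <= n ->
  last_edge (d_ i x) = last_edge x.
Proof.
elim: n i x => [|n IH] [|i] x hi //.
rewrite last_edgeS [RHS]last_edgeS -[RHS](IH i (d_ 0 x)) //.
congr (@last_edge X n _).
by apply: (@faceK X n.+1 0 i.+1); lia.
Qed.

Lemma last_edge_degen n i (x : X n.+1) : i <= n ->
  last_edge (s_ i x) = last_edge x.
Proof.
elim: n i x => [|n IH] [|i] x hi //; rewrite last_edgeS.
- by congr (@last_edge X _ _); exact: face_degen_eq.
- by congr (@last_edge X _ _); exact: face_degen_eq.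
rewrite [RHS]last_edgeS -[RHS](IH i (d_ 0 x)) //.
congr (@last_edge X n.+1 _).
by apply: (@face_degen_lt X n.+1 0 i.+1); lia.
Qed.

Lemma slice_face_cond n (i : 'I_n.+2) (st : slice_simplices n.+1) :
  slice_cond (d_ i (sval st).1, d_ i (sval st).2).
Proof.
case: st => -[a b] [/= ha hb hab]; have hi := ltn_ord i.
have E (c : X n.+3) : d_ n.+1 (d_ i c) = d_ i (d_ n.+2 c).
  by symmetry; apply: (@faceK X n.+1 i n.+2); lia.
split => /=.
- by rewrite -ha; exact: (@last_edge_face n.+1).
- by rewrite -hb; exact: (@last_edge_face n.+1).
- by rewrite !E hab.
Qed.

Lemma slice_degen_cond n (i : 'I_n.+1) (st : slice_simplices n) :
  slice_cond (s_ i (sval st).1, s_ i (sval st).2).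
Proof.
case: st => -[a b] [/= ha hb hab]; have hi := ltn_ord i.
have E (c : X n.+2) : d_ n.+2 (s_ i c) = s_ i (d_ n.+1 c).
  by apply: (@face_degen_gt X n.+1 n.+2 i); lia.
split => /=.
- by rewrite -ha; apply: (@last_edge_degen n.+1); lia.
- by rewrite -hb; apply: (@last_edge_degen n.+1); lia.
- by rewrite !E hab.
Qed.

Definition slice_face n (i : 'I_n.+2) (st : slice_simplices n.+1) :
  slice_simplices n := exist _ _ (slice_face_cond i st).

Definition slice_degen n (i : 'I_n.+1) (st : slice_simplices n) :
  slice_simplices n.+1 := exist _ _ (slice_degen_cond i st).

Lemma slice_eq n (u v : slice_simplices n) :
  (sval u).1 = (sval v).1 -> (sval u).2 = (sval v).2 -> u = v.
Proof.
case: u v => -[a b] hu [[a' b'] hv] /= ea eb.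
by apply: eq_exist; rewrite ea eb.
Qed.

Definition slice : sset.
Proof.
apply: (@SSet slice_simplices slice_face slice_degen).
- move=> n i j x hij; apply: slice_eq => /=; rewrite !inordK; try lia;
    by apply: (@faceK X n.+2); lia.
- move=> n i j x hij; apply: slice_eq => /=; rewrite !inordK; try lia;
    by apply: (@face_degen_lt X n.+2); lia.
- move=> n j x hj; apply: slice_eq => /=; rewrite !inordK; try lia;
    by apply: (@face_degen_eq X n.+2); lia.
- move=> n j x hj; apply: slice_eq => /=; rewrite !inordK; try lia;
    by apply: (@face_degen_succ X n.+2); lia.
- move=> n i j x hij; apply: slice_eq => /=; rewrite !inordK; try lia;
    by apply: (@face_degen_gt X n.+2); lia.
- move=> n i j x hij; apply: slice_eq => /=; rewrite !inordK; try lia;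
    by apply: (@degenK X n.+2); lia.
Defined.

End Slice.

(* The square with sides p : w -> x, q : w -> y, f : x -> z, g : y -> z,
   filled by some pair of 2-simplices with a common diagonal w -> z, is a
   limit cone over the cospan (f, g). *)
Definition is_pullback (C : infcat) (w x y z : C 0) (p : edge w x)
    (q : edge w y) (f : edge x z) (g : edge y z) : Prop :=
  exists v : slice (earr f) (earr g) 0,
    [/\ d_ 2 (sval v).1 = earr p, d_ 2 (sval v).2 = earr q & final v].

Definition has_pullbacks (C : infcat) : Prop :=
  forall (x y z : C 0) (f : edge x z) (g : edge y z),
    exists (w : C 0) (p : edge w x) (q : edge w y), is_pullback p q f g.

Local Open Scope ring_scope.

(* The pullback axiom is stated for one side of the square only: the cospan
   (f, g) is arbitrary, so the other side is obtained by transposition. *)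
Record connectivity_structure (C : infcat) := ConnectivityStructure {
  connected : int -> forall x y : hcat C, mor x y -> Prop;
  connected_pred : forall k (x y : hcat C) (f : mor x y),
    connected k f -> connected (k - 1) f;
  connected_iso : forall k (x y : hcat C) (f : mor x y),
    is_iso f -> connected k f;
  connected_pullback : forall k (w x y z : C 0) (p : edge w x) (q : edge w y)
    (f : edge x z) (g : edge y z), is_pullback p q f g ->
    connected k (hclass g : @mor (hcat C) y z) ->
    connected k (hclass p : @mor (hcat C) w x);
  connected_comp : forall k (x y z : hcat C) (f : mor x y) (g : mor y z),
    connected k f -> connected k g -> connected k (mcomp g f);
  connected_cancel_left : forall k (x y z : hcat C) (f : mor x y)
    (g : mor y z),
    connected (k - 1) f -> connected k (mcomp g f) -> connected k g;
  connected_cancel_right : forall k (x y z : hcat C) (f : mor x y)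
    (g : mor y z),
    connected k (mcomp g f) -> connected (k + 1) g -> connected k f }.

Section Skeleta.
Variables (C : infcat) (K : connectivity_structure C).

Definition skeletal (k : int) (B : hcat C) : Prop :=
  forall (U V : hcat C) (p : mor U V), connected K k p ->
    forall b : mor B V, exists l : mor B U, mcomp p l = b.

Definition minimal_skeleton (k : int) (A X : hcat C) (f : mor A X) : Prop :=
  skeletal k A /\ connected K (k + 1) f.

End Skeleta.

(* Main.v *)
Require Import Defs.
From mathcomp Require Import all_boot all_order all_algebra.

Set Implicit Arguments.
Unset Strict Implicit.
Unset Printing Implicit Defensive.

(* Lifting f1 through f2 gives u, which is k-connected by cancellation; lifting
   the identity through u gives a right inverse v, again over X and so again
   k-connected, hence v has a right inverse too and u is an isomorphism.  For
   uniqueness, two maps u, u' over X induce b : A1 -> A2 x_X A2.  The diagonal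
   of f2 is k-connected, being a section of a (k+1)-connected projection, so b
   lifts through it, and the lift equals both u and u'.  The pullback is only
   used through its weak universal property in the homotopy category. *)

(** This is [triangleA] with an identity as third edge. It lets the two halves of a square that
    commutes up to homotopy share a strict diagonal, as [slice_cond] demands. *)
Lemma triangle_homotopic_r (C : infcat) (x y z : C 0) (f : edge x y)
    (g : edge y z) (h h' : edge x z) :
  homotopic h h' -> triangle f g h -> triangle f g h'.
Proof. by move=> hh' fgh; exact: triangleA fgh (triangle_idr g) hh'. Qed.

(** Both cones are vertices of the slice, and finality of the limit cone gives an edge between
    them. *)
Lemma pullback_edge_lift (C : infcat) (w x y z : C 0) (p : edge w x)
    (q : edge w y) (f : edge x z) (g : edge y z) (a : C 0) (r : edge a x)
    (s : edge a y) (h : edge a z) :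
  is_pullback p q f g -> triangle r f h -> triangle s g h ->
  exists c : edge a w, triangle c p r /\ triangle c q s.
Proof.
move=> [v [vp vq vfinal]] [t [t2 t0 t1]] [t' [t'2 t'0 t'1]].
have cond : slice_cond (earr f) (earr g) (n := 0) (t, t').
  by split => //=; rewrite t1 t'1.
pose u : slice (earr f) (earr g) 0 := exist _ (t, t') cond.
(* Face 0 of an edge is its target, so [e] runs from [u] to [v]. *)
have [//|//|e he] :=
  vfinal 0 (fun i : 'I_2 => if i == ord0 then v else u).
have d0e : d_ 0 e = v by rewrite /d_ he -val_eqE /= inordK.
have d1e : d_ 1 e = u by rewrite /d_ he -val_eqE /= inordK.
(* The 3-simplices [l] and [m] have vertices a, w, x, z and a, w, y, z. By [lm] they share the face
   a, w, z, hence the edge from a to w, which is the required [c]. *)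
case: e {he} d0e d1e => -[l m] [/= l_f m_g lm] d0e d1e.
have l0 : d_ 0 l = (sval v).1 by rewrite -d0e /= /d_ /= !inordK.
have m0 : d_ 0 m = (sval v).2 by rewrite -d0e /= /d_ /= !inordK.
have l1 : d_ 1 l = t by rewrite -[t]/(sval u).1 -d1e /= /d_ /= !inordK.
have m1 : d_ 1 m = t' by rewrite -[t']/(sval u).2 -d1e /= /d_ /= !inordK.
have faces (n : C 3) : [/\ d_ 2 (d_ 3 n) = d_ 2 (d_ 2 n),
    d_ 0 (d_ 3 n) = d_ 2 (d_ 0 n) & d_ 1 (d_ 3 n) = d_ 2 (d_ 1 n)].
  split; [exact: (@faceK C 1 2 3) | exact: (@faceK C 1 0 3)
         | exact: (@faceK C 1 1 3)].
have [l32 l30 l31] := faces l; have [m32 m30 m31] := faces m.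
have csrc : d_ 1 (d_ 2 (d_ 2 l)) = a.
  rewrite -[RHS](esrc r) -t2 -l1 -l31 -l32; exact: (@faceK C 0 1 2).
have ctgt : d_ 0 (d_ 2 (d_ 2 l)) = w.
  rewrite -[RHS](esrc p) -vp -l0 -l30 -l32; exact: (@faceK C 0 0 2).
exists (Edge csrc ctgt); split; [exists (d_ 3 l) | exists (d_ 3 m)].
- by split; rewrite ?l32 ?l30 ?l31 ?l0 ?l1.
- by split; rewrite ?m32 ?m30 ?m31 ?m0 ?m1 /= ?lm.
Qed.

Lemma pullback_hhom_lift (C : infcat) (w x y z : C 0) (p : edge w x)
    (q : edge w y) (f : edge x z) (g : edge y z) (a : C 0) (r : hhom a x)
    (s : hhom a y) :
  is_pullback p q f g -> hcomp (hclass f) r = hcomp (hclass g) s ->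
  exists c : hhom a w, hcomp (hclass p) c = r /\ hcomp (hclass q) c = s.
Proof.
move=> pb; rewrite -[r]hreprK -[s]hreprK.
have [h rfh] := triangle_ex (hrepr r) f.
have [h' sgh'] := triangle_ex (hrepr s) g.
rewrite (hcompP rfh) (hcompP sgh') => /esym/hclassP hh'.
have [c [cp cq]] := pullback_edge_lift pb rfh (triangle_homotopic_r hh' sgh').
by exists (hclass c); rewrite (hcompP cp) (hcompP cq).
Qed.

Section Skeleta.
Variables (C : infcat) (K : connectivity_structure C) (k : int).
Local Open Scope ring_scope.

Lemma connected_id (A : hcat C) : connected K k (idm A).
Proof.
by apply: connected_iso; exists (idm A); rewrite mcomp_idl.
Qed.

Lemma connected_succ (A B : hcat C) (f : mor A B) :
  connected K (k + 1) f -> connected K k f.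
Proof. by move=> /connected_pred; rewrite GRing.addrK. Qed.

Lemma skeletal_lift_unique (hC : has_pullbacks C) (A Y X : hcat C)
    (f : mor Y X) (u v : mor A Y) :
  skeletal K k A -> connected K (k + 1) f -> mcomp f u = mcomp f v -> u = v.
Proof.
move=> skA fconn; have [P [p [q pb]]] := hC _ _ _ (hrepr f) (hrepr f).
have lift (B : hcat C) (r s : mor B Y) : mcomp f r = mcomp f s ->
    exists c : @mor (hcat C) B P, mcomp (hclass p : @mor (hcat C) P Y) c = r /\
      mcomp (hclass q : @mor (hcat C) P Y) c = s.
  by move=> rs; apply: (pullback_hhom_lift pb); rewrite hreprK.
have pconn : connected K (k + 1) (hclass p : @mor (hcat C) P Y).
  by apply: connected_pullback pb _; rewrite hreprK.
have [delta [pdelta qdelta]] := lift Y (idm Y) (idm Y) erefl.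
(* Cancellation costs one degree: [p] is (k+1)-connected, its section only k-connected. *)
have dconn : connected K k delta.
  by apply: connected_cancel_right pconn; rewrite pdelta; exact: connected_id.
move=> /lift[b [<- <-]]; have [l <-] := skA _ _ _ dconn b.
by rewrite !mcompA pdelta qdelta.
Qed.

(** The conclusion [mcomp f1 v = f2] allows a second application, to [v] with the two skeleta
    exchanged. *)
Lemma skeletal_right_inverse (A1 A2 X : hcat C) (f1 : mor A1 X)
    (f2 : mor A2 X) (u : mor A1 A2) :
  minimal_skeleton K k f1 -> minimal_skeleton K k f2 -> mcomp f2 u = f1 ->
  exists v : mor A2 A1, mcomp u v = idm A2 /\ mcomp f1 v = f2.
Proof.
move=> [_ f1conn] [sk2 f2conn] uX.
have uconn : connected K k u.
  apply: connected_cancel_right f2conn; rewrite uX; exact: connected_succ.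
have [v uv] := sk2 _ _ _ uconn (idm A2).
by exists v; rewrite -uX -mcompA uv mcomp_idr.
Qed.

End Skeleta.

Theorem proposition3p20 (C : infcat) (hC : has_pullbacks C)
    (K : connectivity_structure C) (k : int) (X A1 A2 : hcat C)
    (f1 : mor A1 X) (f2 : mor A2 X)
    (h1 : minimal_skeleton K k f1) (h2 : minimal_skeleton K k f2) :
  exists! u : mor A1 A2, is_iso u /\ mcomp f2 u = f1.
Proof.
have [sk1 _] := h1; have [_ f2conn] := h2.
have [u uX] := sk1 _ _ _ (connected_succ f2conn) f1.
exists u; split; last first.
  by move=> u' [_ u'X]; apply: (skeletal_lift_unique hC sk1 f2conn); rewrite uX.
split=> //; have [v [uv vX]] := skeletal_right_inverse h1 h2 uX.
have [w [vw _]] := skeletal_right_inverse h2 h1 vX.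
have uw : u = w by rewrite -[u]mcomp_idr -vw mcompA uv mcomp_idl.
by exists v; rewrite uv [in mcomp v u]uw.
Qed.
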